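(* Let $X$ be a geodesic metric space with injective hull $e:X\to E(X)$. Let $\gamma\subseteq X$ be a strongly contracting geodesic. Then $e(\gamma)$ is strongly contracting in $E(X)$, quantitatively: for every $C\ge 0$ there is $D\ge 0$, depending only on $C$, such that if $\gamma$ is a $C$-strongly contracting geodesic in a geodesic metric space $X$, then $e(\gamma)$ is $D$-strongly contracting in $E(X)$.
   Context: For a metric space $(X,d)$ let $\Delta=\{f\in\mathbb{R}^X : f(x)+f(y)\ge d(x,y)\ \forall x,y\in X\}$, partially ordered by $f\le g$ iff $f(x)\le g(x)$ for all $x\in X$. The injective hull $E(X)$ is the set of minimal elements of $\Delta$, with the metric $d_\infty(f,g)=\sup_{x\in X}|f(x)-g(x)|$. The map $e:X\to E(X)$, $x\mapsto d(x,\cdot)$, is an isometric embedding. For a subset $Y$ of a metric space $Z$ and $x\in Z$, let $\pi_Y(x)=\{y\in Y: d(x,y)\le d(x,Y)+1\}$, and for $B\subseteq Z$ let $\pi_Y(B)=\bigcup_{x\in B}\pi_Y(x)$. $Y$ is $D$-strongly contracting in $Z$ if $\mathrm{diam}(\pi_Y(B))\le D$ for every closed ball $B$ of $Z$ disjoint from $Y$; it is strongly contracting if it is $D$-strongly contracting for some $D$. *)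

(* Defs.v *)
From HB Require Import structures.
From mathcomp Require Import all_boot all_order all_algebra.
From mathcomp Require Import all_classical all_reals all_analysis.
From mathcomp Require Import lra.

Set Implicit Arguments.
Unset Strict Implicit.
Unset Printing Implicit Defensive.

Import Order.TTheory GRing.Theory Num.Theory.
Import numFieldTopology.Exports.

Local Open Scope classical_set_scope.
Local Open Scope ring_scope.

Section StrongContraction.
Context {R : realType} {Z : metricType R}.
Implicit Types (x c : Z) (Y A B : set Z).

(* The library's [closed_ball] is the closure of the open ball, which can be
   smaller than the metric closed ball. *)
Definition metric_cball c (r : R) : set Z := [set z | mdist c z <= r].

Definition dist_to Y x : R := inf [set mdist x y | y in Y].

Definition coarse_proj Y x : set Z :=
  [set y | Y y /\ mdist x y <= dist_to Y x + 1].

Definition coarse_proj_set Y B : set Z := \bigcup_(x in B) coarse_proj Y x.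

(* Equal to -oo, not 0, on the empty set; this is immaterial for upper bounds
   by nonnegative reals. *)
Definition diam A : \bar R :=
  ereal_sup [set (mdist p.1 p.2)%:E | p in A `*` A].

Definition strongly_contracting_with (D : R) Y : Prop :=
  forall c r, 0 <= r -> metric_cball c r `&` Y = set0 ->
    (diam (coarse_proj_set Y (metric_cball c r)) <= D%:E)%E.

Definition strongly_contracting Y : Prop :=
  exists D : R, strongly_contracting_with D Y.

End StrongContraction.

Section Geodesics.
Context {R : realType}.

Definition isometric_on (X : metricType R) (I : set R) (c : R -> X) : Prop :=
  forall s t, I s -> I t -> mdist (c s) (c t) = `|s - t|.

Definition geodesic_space (X : metricType R) : Prop :=
  forall x y : X, exists c : R -> X,
    [/\ isometric_on `[0, mdist x y] c, c 0 = x & c (mdist x y) = y].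

(* Segments, rays and lines are all allowed, as are single points. *)
Definition geodesic (X : metricType R) (gamma : set X) : Prop :=
  exists (I : set R) (c : R -> X),
    [/\ I !=set0, is_interval I, closed I, isometric_on I c
      & gamma = c @` I].

End Geodesics.

Section Extremal.
Context {R : realType} {X : metricType R}.
Implicit Types (f g : X -> R) (x y : X).

Definition hull_Delta : set (X -> R) :=
  [set f | forall x y, mdist x y <= f x + f y].

Definition hull_minimal f : Prop :=
  hull_Delta f /\
  forall g, hull_Delta g -> (forall x, g x <= f x) -> g = f.

Lemma hull_Delta_ge0 f x : hull_Delta f -> 0 <= f x.
Proof. by move=> /(_ x x); rewrite mdistxx => ?; lra. Qed.

Lemma hull_minimal_le f x y : hull_minimal f -> f x <= f y + mdist x y.
Proof.
move=> [fD fmin]; rewrite leNgt; apply/negP => lt_fx.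
pose g z := if z == x then f y + mdist x y else f z.
have gD : hull_Delta g.
  have f0 := hull_Delta_ge0 y fD; have d0 := mdist_ge0 x y.
  have key z : mdist x z <= f y + mdist x y + f z.
    have := metric_triangle x y z; have := fD y z; lra.
  move=> u v; rewrite /g; case: eqP => [->|_]; case: eqP => [->|_] //.
  - by rewrite mdistxx; lra.
  - by rewrite metric_sym addrC.
have /(congr1 (fun h => h x)) : g = f.
  apply: fmin => // z; rewrite /g; case: eqP => [->|_ //]; exact: ltW.
by rewrite /g eqxx => gx; rewrite gx ltxx in lt_fx.
Qed.

Lemma dist_fun_minimal x : hull_minimal (mdist x).
Proof.
split=> [y z|g gD le_g].
  by rewrite (metric_sym x y); exact: metric_triangle.
apply/funext => y; apply/eqP; rewrite eq_le le_g /=.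
have := le_g x; rewrite mdistxx => gx; have := gD x y; lra.
Qed.

End Extremal.

Record injective_hull (R : realType) (X : metricType R) := InjectiveHull {
  hull_fun :> X -> R;
  hull_funP : hull_minimal hull_fun }.

Section HullMetric.
Context {R : realType} {X : metricType R}.
Implicit Types f g h : injective_hull X.

Definition hull_dist f g : R := sup [set `|f x - g x| | x in [set: X]].

Lemma hull_ext f g : (forall x, f x = g x) -> f = g.
Proof.
case: f g => [f fP] [g gP] /= /funext fg.
by move: fP gP; rewrite fg => fP gP; rewrite (Prop_irrelevance fP gP).
Qed.

Lemma hull_dist_ubound f g :
  has_ubound [set `|f x - g x| | x in [set: X]].
Proof.
case: (pselect (exists x0 : X, True)) => [[x0 _]|noX]; last first.
  by exists 0 => _ [x _ <-]; exfalso; apply: noX; exists x.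
exists (f x0 + g x0) => _ [x _ <-].
have := hull_minimal_le x x0 (hull_funP f).
have := hull_minimal_le x x0 (hull_funP g).
have := (hull_funP f).1 x x0; have := (hull_funP g).1 x x0.
by rewrite ler_norml => *; apply/andP; split; lra.
Qed.

Lemma hull_dist_ge f g x : `|f x - g x| <= hull_dist f g.
Proof. by apply: ub_le_sup; [exact: hull_dist_ubound|exists x]. Qed.

Lemma hull_dist_le f g (r : R) :
  0 <= r -> (forall x, `|f x - g x| <= r) -> hull_dist f g <= r.
Proof.
move=> r0 le_r; rewrite /hull_dist.
have [->|/set0P ne] := eqVneq [set `|f x - g x| | x in [set: X]] set0.
  by rewrite sup0.
by apply: ge_sup => // _ [x _ <-].
Qed.

Lemma hull_dist_ge0 f g : 0 <= hull_dist f g.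
Proof.
case: (pselect (exists x0 : X, True)) => [[x _]|noX].
  exact: le_trans (hull_dist_ge f g x).
suff E : [set `|f x - g x| | x in [set: X]] = set0 by rewrite /hull_dist E sup0.
by rewrite -subset0 => r [x _ _]; apply: noX; exists x.
Qed.

Lemma hull_distxx f : hull_dist f f = 0.
Proof.
apply/eqP; rewrite eq_le hull_dist_ge0 andbT.
by apply: hull_dist_le => // x; rewrite subrr normr0.
Qed.

Lemma hull_dist_eq0 f g : hull_dist f g = 0 -> f = g.
Proof.
move=> fg0; apply: hull_ext => x; apply/eqP; rewrite -subr_eq0 -normr_le0.
by rewrite -fg0; exact: hull_dist_ge.
Qed.

Lemma hull_dist_sym f g : hull_dist f g = hull_dist g f.
Proof.
by congr sup; apply/seteqP; split=> _ [x _ <-]; exists x; rewrite // distrC.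
Qed.

Lemma hull_dist_triangle g f h :
  hull_dist f h <= hull_dist f g + hull_dist g h.
Proof.
apply: hull_dist_le => [|x]; first by rewrite addr_ge0 ?hull_dist_ge0.
by rewrite (le_trans (ler_distD (g x) _ _))// lerD ?hull_dist_ge.
Qed.

HB.instance Definition _ := gen_eqMixin (injective_hull X).
HB.instance Definition _ := gen_choiceMixin (injective_hull X).
HB.instance Definition _ := @isMetric.Build R (injective_hull X) hull_dist
  hull_distxx hull_dist_eq0 hull_dist_sym hull_dist_triangle.

Definition hull_embed (x : X) : injective_hull X :=
  InjectiveHull (dist_fun_minimal x).

Lemma hull_embed_isometry x y :
  mdist (hull_embed x) (hull_embed y) = mdist x y.
Proof.
apply/eqP; rewrite eq_le; apply/andP; split.
  apply: hull_dist_le => [|z /=]; first exact: mdist_ge0.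
  have := metric_triangle x y z; have := metric_triangle y x z.
  by rewrite (metric_sym y x) ler_norml => *; apply/andP; split; lra.
have := hull_dist_ge (hull_embed x) (hull_embed y) y.
by rewrite /= mdistxx subr0 ger0_norm // mdist_ge0.
Qed.

End HullMetric.

(* Main.v *)
Require Import Defs.
From HB Require Import structures.
From mathcomp Require Import all_boot all_order all_algebra.
From mathcomp Require Import all_classical all_reals all_analysis.
From mathcomp Require Import lra.

Set Implicit Arguments.
Unset Strict Implicit.
Unset Printing Implicit Defensive.

Import Order.TTheory GRing.Theory Num.Theory.

Local Open Scope classical_set_scope.
Local Open Scope ring_scope.

(** Write [r_y] for the distance from a point [y] of [X] to the geodesic
    [gamma] and [z_y] for a coarse projection of [y], and write [~] for an
    equality, and [>~] for an inequality, up to an error that depends only on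
    the contraction constant [C].

    Strong contraction in the geodesic space [X] says that long projections
    force geodesics to run close to [gamma]: if [d(z_y, z_y')] is large then
    [d(y, y') >~ r_y + d(z_y, z_y') + r_y'] ([far_projections_dist]), and
    [d(y, p) >~ r_y + d(z_y, p)] for [p] in [gamma] ([dist_via_projection]).

    The distance in the hull from [f] to [e x] is [f x], so projecting [f] to
    [e(gamma)] means nearly minimizing the function [f] on [gamma].
    Minimality of [f] makes [f p ~ d(p, y) - f y] for some partner [y] of [p];
    thus, on [gamma], [f] is up to bounded error a supremum of functions
    [p |-> d(p, z_y) + const].  Such a function is coarsely convex with slopes
    [1] and [-1], hence grows at unit speed away from any near minimum [a]:
    [f q >~ f a + d(a, q)] ([hull_growth_from_min]).

    Now let [f] and [g] be in the hull, with near minima [a] and [b] on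
    [gamma] at large distance.  By the growth estimate, a partner [y] for [f]
    of the far point [b] projects to the side of [a] away from [b], and is
    also a partner of [a]; likewise a partner [y'] for [g] of [a] projects
    beyond [b], and is a partner of [b].  So a geodesic from [y] to [y'] runs
    along [gamma] through [a] and [b], and

      [d(f, g) >= g y - f y >= d(y, y') - g y' - f y
                >~ d(y, a) + d(a, b) + d(b, y') - g y' - f y
                >~ f a + d(a, b) + g b].

    If [g] lies in a ball about [f] that misses [e(gamma)], the left-hand side
    is smaller than [f a], so [d(a, b)] is bounded ([hull_projections_close]).
    The projection of the ball is therefore close to that of its centre. *)

(** * Distance to a set and coarse projection *)

Section CoarseProjection.
Context {R : realType} {X : metricType R}.
Implicit Types (x y z w p : X) (Y : set X).

Lemma dist_to_ge0 Y x : 0 <= dist_to Y x.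
Proof.
rewrite /dist_to; have [->|/set0P ne] := eqVneq [set mdist x y | y in Y] set0.
  by rewrite inf0.
by apply: lb_le_inf => // _ [y _ <-]; exact: mdist_ge0.
Qed.

Lemma dist_to_le Y x y : Y y -> dist_to Y x <= mdist x y.
Proof.
move=> Yy; apply: ge_inf; last by exists y.
by exists 0 => _ [z _ <-]; exact: mdist_ge0.
Qed.

Lemma coarse_projN0 Y x : Y !=set0 -> exists z, coarse_proj Y x z.
Proof.
move=> [y0 Yy0].
have [||_ [z Yz <-] lt_z] := @inf_adherent _ [set mdist x y | y in Y] 1.
- exact: ltr01.
- split; first by exists (mdist x y0), y0.
  by exists 0 => _ [z _ <-]; exact: mdist_ge0.
- by exists z; split => //; exact: ltW.
Qed.

Lemma coarse_proj_self Y p : Y p -> coarse_proj Y p p.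
Proof.
by move=> Yp; split=> //; rewrite mdistxx; have := dist_to_ge0 Y p; lra.
Qed.

Lemma geodesic_point x y (s : R) : geodesic_space X ->
  0 <= s <= mdist x y -> exists w, mdist x w = s /\ mdist w y = mdist x y - s.
Proof.
move=> gX /andP[s0 sd]; have [c [iso c0 cd]] := gX x y; exists (c s).
have Is : `[0, mdist x y]%classic s by rewrite /= in_itv /= s0 sd.
split.
- rewrite -[in LHS]c0 iso // ?sub0r ?normrN ?ger0_norm //.
  by rewrite /= in_itv /= lexx mdist_ge0.
- rewrite -[in LHS]cd iso //; first by rewrite distrC ger0_norm // subr_ge0.
  by rewrite /= in_itv /= lexx mdist_ge0.
Qed.

End CoarseProjection.

(** * Consequences of strong contraction in a geodesic space *)

Section Contracting.
Context {R : realType} {X : metricType R} (C : R) (Y : set X).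
Hypotheses (C0 : 0 <= C) (Y0 : Y !=set0) (gX : geodesic_space X).
Hypothesis contrY : strongly_contracting_with C Y.
Implicit Types (w x y z p : X).

Lemma contracting_ball x y z z' (s : R) : 0 <= s < dist_to Y x ->
  mdist x y <= s -> coarse_proj Y x z -> coarse_proj Y y z' ->
  mdist z z' <= C.
Proof.
move=> /andP[s0 sr] xy pz pz'; rewrite -lee_fin.
apply: le_trans (contrY (c := x) s0 _); last first.
  apply/seteqP; split=> [p [/= xp Yp]|//].
  by have := dist_to_le x Yp; rewrite leNgt (le_lt_trans xp sr).
apply: ereal_sup_ubound; exists (z, z') => //; split => /=.
- by exists x => //; rewrite /metric_cball /= mdistxx.
- by exists y.
Qed.

(** A variant that needs no lower bound on the distance to [Y]: within
    distance 1 of [Y] the ball is a point, whose projection has diameter at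
    most 4. *)
Lemma retreat_projection x y z z' : mdist x y <= Num.max 0 (dist_to Y x - 1) ->
  coarse_proj Y x z -> coarse_proj Y y z' -> mdist z z' <= C + 4.
Proof.
have C_ge0 := C0.
move=> xy pz pz'; have [r1|r1] := leP 1 (dist_to Y x).
  apply: (@le_trans _ _ C); last lra.
  apply: (contracting_ball (s := dist_to Y x - 1) _ _ pz pz'); first lra.
  by rewrite max_r in xy; lra.
rewrite max_l in xy; last lra.
have /mdist_positivity yx : mdist x y = 0.
  by apply/eqP; rewrite eq_le xy mdist_ge0.
subst y; have [_ xz] := pz; have [_ xz'] := pz'.
by have := metric_triangle z x z'; rewrite (metric_sym z x); lra.
Qed.

(** One moves along a geodesic from [w] to [w'], from an end far from [Y], by
    about the distance to [Y].  The projection moves by at most [C], which is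
    less than the length travelled, so no error accumulates; only the final
    position, with both ends close to [Y], contributes to the constant. *)
Lemma coarse_proj_lipschitz w w' z z' : coarse_proj Y w z ->
  coarse_proj Y w' z' -> mdist z z' <= mdist w w' + (2 * C + 6).
Proof.
have C_ge0 := C0.
have [n] : exists n : nat, mdist w w' <= n%:R.
  exists (Num.bound (mdist w w')); apply/ltW/archi_boundP; exact: mdist_ge0.
elim: n w w' z z' => [|n IHn] w w' z z' le_n pz pz'.
  have /mdist_positivity ww' : mdist w w' = 0.
    by apply/eqP; rewrite eq_le le_n mdist_ge0.
  subst w'; have := @retreat_projection w w z z'; rewrite mdistxx => h.
  by have := h _ pz pz'; rewrite le_max lexx => /(_ isT); lra.
have step u u' v v' : mdist u u' <= n.+1%:R -> coarse_proj Y u v ->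
    coarse_proj Y u' v' -> C + 2 <= dist_to Y u ->
    mdist v v' <= mdist u u' + (2 * C + 6).
  move=> uun pv pv' Cr.
  have s_range : 0 <= dist_to Y u - 1 < dist_to Y u by lra.
  have [le_s|/ltW lt_s] := leP (mdist u u') (dist_to Y u - 1).
    have := contracting_ball s_range le_s pv pv'.
    by have := mdist_ge0 u u'; lra.
  have [|u1 [uu1 u1u']] := @geodesic_point _ _ u u' (dist_to Y u - 1) gX.
    by apply/andP; split; lra.
  have [v1 pv1] := coarse_projN0 u1 Y0.
  have uu1' : mdist u u1 <= dist_to Y u - 1 by lra.
  have vv1 := contracting_ball s_range uu1' pv pv1.
  have : mdist v1 v' <= mdist u1 u' + (2 * C + 6).
    by apply: IHn => //; rewrite -natr1 in uun; lra.
  by have := metric_triangle v v1 v'; lra.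
have [Cr|Cr] := leP (C + 2) (dist_to Y w); first exact: step.
have [Cr'|Cr'] := leP (C + 2) (dist_to Y w').
  rewrite metric_sym (metric_sym w); apply: step => //.
  by rewrite metric_sym.
have [_ wz] := pz; have [_ wz'] := pz'.
have := metric_triangle z w z'; have := metric_triangle w w' z'.
rewrite (metric_sym z w); lra.
Qed.

Lemma far_projections_dist y y' z z' : coarse_proj Y y z ->
  coarse_proj Y y' z' -> 2 * C + 8 < mdist z z' ->
  dist_to Y y + mdist z z' + dist_to Y y' <= mdist y y' + (4 * C + 16).
Proof.
have C_ge0 := C0.
move=> pz pz' far.
set s := Num.max 0 (dist_to Y y - 1); set s' := Num.max 0 (dist_to Y y' - 1).
have [s0 s1] : 0 <= s /\ dist_to Y y - 1 <= s.
  by split; rewrite le_max lexx ?orbT.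
have [s'0 s'1] : 0 <= s' /\ dist_to Y y' - 1 <= s'.
  by split; rewrite le_max lexx ?orbT.
(* If the two balls met, both projections would be close to that of a common
   point. *)
have lt_ss' : s + s' < mdist y y'.
  rewrite ltNge; apply/negP => le_d.
  have [w [yw wy']] : exists w, mdist y w <= s /\ mdist y' w <= s'.
    have [le_s|/ltW lt_s] := leP (mdist y y') s.
      by exists y'; rewrite mdistxx.
    have [|w [yw wy']] := @geodesic_point _ _ y y' s gX; first by rewrite s0.
    by exists w; rewrite (metric_sym y'); split; lra.
  have [v pv] := coarse_projN0 w Y0.
  have := retreat_projection yw pz pv; have := retreat_projection wy' pz' pv.
  by have := metric_triangle z v z'; rewrite (metric_sym z' v); lra.
have [|w [yw wy']] := @geodesic_point _ _ y y' s gX.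
  by apply/andP; split; lra.
have [|w' [ww' w'y']] := @geodesic_point _ _ w y' (mdist w y' - s') gX.
  by apply/andP; split; lra.
have [v pv] := coarse_projN0 w Y0; have [v' pv'] := coarse_projN0 w' Y0.
have zv : mdist z v <= C + 4 by apply: retreat_projection pz pv; rewrite yw.
have zv' : mdist z' v' <= C + 4.
  by apply: retreat_projection pz' pv'; rewrite metric_sym -/s'; lra.
have := coarse_proj_lipschitz pv pv'.
have := metric_triangle z v z'; have := metric_triangle v v' z'.
rewrite (metric_sym v' z'); lra.
Qed.

Lemma dist_via_projection y z p : coarse_proj Y y z -> Y p ->
  dist_to Y y + mdist z p <= mdist y p + (4 * C + 16).
Proof.
have C_ge0 := C0.
move=> pz Yp; have [near|far] := leP (mdist z p) (2 * C + 8).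
  by have := dist_to_le y Yp; lra.
have := far_projections_dist pz (coarse_proj_self Yp) far.
by have := dist_to_ge0 Y p; lra.
Qed.

End Contracting.

(** * Metric relations between points of a geodesic *)

Section GeodesicLine.
Context {R : realType} {X : metricType R} (gamma : set X).
Hypothesis gamma_geo : geodesic gamma.

Lemma geodesicN0 : gamma !=set0.
Proof. by have [I [c [[t It] _ _ _ ->]]] := gamma_geo; exists (c t), t. Qed.

(** Removing the point [t] separates [p] from [q], so every point [z] lies
    beyond [t] as seen from one of them. *)
Lemma geodesic_cut p q (T : R) : gamma p -> gamma q -> 0 <= T <= mdist p q ->
  exists t, [/\ gamma t, mdist p t = T, mdist t q = mdist p q - T
    & forall z, gamma z -> mdist p z = mdist p t + mdist t z \/
                           mdist q z = mdist q t + mdist t z].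
Proof.
have [I [c [_ itvI _ iso ->]]] := gamma_geo.
move=> [s Is <-] [u Iu <-]; rewrite iso // => /andP[T0 Tle].
pose v := if s <= u then s + T else s - T.
have [Iv v_between] : I v /\ (s <= v <= u \/ u <= v <= s).
  rewrite /v; case: (lerP s u) Tle => su Tle.
    have hv : s <= s + T <= u by apply/andP; split; lra.
    by split; [exact: itvI hv | left].
  have hv : u <= s - T <= s by apply/andP; split; lra.
  by split; [exact: itvI hv | right].
have sv : `|s - v| = T.
  rewrite /v; case: leP => _.
    by rewrite opprD addrA subrr sub0r normrN ger0_norm.
  by rewrite opprB addrC subrK ger0_norm.
exists (c v); split; first by exists v.
- by rewrite iso.
- move: sv; rewrite !iso // => <-.
  case: v_between => /andP[h1 h2];
  case: (lerP s v); case: (lerP v u); case: (lerP s u); lra.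
- move=> _ [w Iw <-]; rewrite !iso //.
  case: v_between => /andP[h1 h2]; case: (lerP v w) => vw.
  + left; case: (lerP s w); case: (lerP s v); lra.
  + right; case: (lerP u w); case: (lerP u v); lra.
  + right; case: (lerP u w); case: (lerP u v); lra.
  + left; case: (lerP s w); case: (lerP s v); lra.
Qed.

(** If [z] is coarsely on the side of [a] away from [b], and [z'] on the side
    of [b] away from [a], then the four points are coarsely aligned in the
    order [z], [a], [b], [z'].  If [E] exceeded [2 d(a, b)], both hypotheses
    could hold with [z] and [z'] on the same side of [a] and [b]. *)
Lemma geodesic_align a b z z' (E : R) :
  gamma a -> gamma b -> gamma z -> gamma z' -> E < 2 * mdist a b ->
  mdist z a + mdist a b <= mdist z b + E ->
  mdist z' b + mdist a b <= mdist z' a + E ->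
  mdist z a + mdist a b + mdist z' b <= mdist z z' + 2 * E.
Proof.
have [I [c [_ _ _ iso ->]]] := gamma_geo.
move=> [s Is <-] [t It <-] [u Iu <-] [v Iv <-]; rewrite !iso //.
case: (lerP u s); case: (lerP s t); case: (lerP u t); case: (lerP v t);
case: (lerP v s); case: (lerP u v); lra.
Qed.

End GeodesicLine.

(** * Minimal functions and their partners *)

Section Hull.
Context {R : realType} {X : metricType R}.
Implicit Types (f g : injective_hull X) (x y : X).

Lemma hull_dist_embed f x : mdist f (hull_embed x) = f x.
Proof.
apply/eqP; rewrite eq_le; apply/andP; split; last first.
  have := hull_dist_ge f (hull_embed x) x; rewrite /= mdistxx subr0.
  by apply: le_trans; rewrite ler_norm.
apply: hull_dist_le => [|y /=]; first exact: hull_Delta_ge0 (hull_funP f).1.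
have := hull_minimal_le y x (hull_funP f); have := (hull_funP f).1 x y.
by rewrite (metric_sym y x) ler_norml => *; apply/andP; split; lra.
Qed.

Lemma hull_partner f x : exists y, f x + f y <= mdist x y + 1.
Proof.
apply: contrapT => no_partner.
have slack y : mdist x y + 1 < f x + f y.
  by rewrite ltNge; apply/negP => le_y; apply: no_partner; exists y.
pose g y := if y == x then f x - 1 / 2 else f y.
have fx := slack x; rewrite mdistxx in fx.
have gD : hull_Delta g.
  move=> u v; rewrite /g; case: eqP => [->|_]; case: eqP => [->|_].
  - by rewrite mdistxx; lra.
  - by have := slack v; lra.
  - by have := slack u; rewrite metric_sym; lra.
  - exact: (hull_funP f).1.
have /(congr1 (fun h => h x)) : g = f.
  by apply: (hull_funP f).2 => // y; rewrite /g; case: eqP => [->|_ //]; lra.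
by rewrite /g eqxx; lra.
Qed.

Lemma coarse_proj_hullP (gamma : set X) f u :
  coarse_proj [set hull_embed x | x in gamma] f u ->
  exists m, [/\ gamma m, u = hull_embed m
    & forall q, gamma q -> f m <= f q + 1].
Proof.
move=> [[m gm <-] le_m]; exists m; split=> // q gq.
rewrite hull_dist_embed in le_m; apply: (le_trans le_m).
by rewrite lerD2r -(hull_dist_embed f q); apply: dist_to_le; exists q.
Qed.

End Hull.

(** * Contraction in the hull *)

Section HullContraction.
Context {R : realType} {X : metricType R} (C : R) (gamma : set X).
Hypotheses (C0 : 0 <= C) (gX : geodesic_space X).
Hypothesis gamma_geo : geodesic gamma.
Hypothesis contr : strongly_contracting_with C gamma.
Implicit Types (f g : injective_hull X) (p q y z : X).

Let K := 4 * C + 16.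
Let gamma0 : gamma !=set0 := geodesicN0 gamma_geo.

Let via_projection y z p : coarse_proj gamma y z -> gamma p ->
  dist_to gamma y + mdist z p <= mdist y p + K.
Proof. exact: dist_via_projection. Qed.

(** Let [t] be the point at distance [K + 4] from [p] towards [q], and [y] a
    partner of [t].  If [y] projected to the side of [t] away from [p], then
    [f p] would exceed [f t] by more than 1; so it projects to the side away
    from [q], and [y] witnesses the growth of [f] from [t] to [q]. *)
Lemma hull_growth_from_min f p q : gamma p ->
  (forall x, gamma x -> f p <= f x + 1) -> gamma q ->
  f p + mdist p q <= f q + (2 * K + 8).
Proof.
have C_ge0 := C0.
have K_ge : 16 <= K by rewrite /K; lra.
move=> gp pmin gq; have [near|/ltW far] := leP (mdist p q) (K + 4).
  by have := pmin _ gq; lra.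
have [|t [gt pt tq cut]] :=
  @geodesic_cut _ _ _ gamma_geo p q (K + 4) gp gq.
  by apply/andP; split; lra.
have [y fty] := hull_partner f t.
have [z pz] := coarse_projN0 y gamma0.
have [gz yz] := pz.
have := metric_triangle y z t; rewrite (metric_sym y t) (metric_sym z t) => yt.
have := pmin _ gt; case: (cut _ gz) => zE.
- have := via_projection pz gp; have := (hull_funP f).1 y p.
  by rewrite (metric_sym z p); lra.
- have := via_projection pz gq; have := (hull_funP f).1 y q.
  by rewrite (metric_sym z q); move: zE; rewrite (metric_sym q t); lra.
Qed.

(** A partner of [b] is also a partner of [a], and it projects to the side
    of [a] away from [b], because [f] grows at unit speed from [a] to [b]. *)
Lemma partner_behind_min f a b : gamma a ->
  (forall x, gamma x -> f a <= f x + 1) -> gamma b -> exists y z,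
  [/\ coarse_proj gamma y z, f y <= mdist y a - f a + (2 * K + 9)
    & mdist z a + mdist a b <= mdist z b + (3 * K + 10)].
Proof.
move=> ga amin gb; have grow := hull_growth_from_min ga amin gb.
have [y fby] := hull_partner f b; have [z pz] := coarse_projN0 y gamma0.
exists y, z; have [_ yz] := pz.
have := metric_triangle y a b; have := metric_triangle y z b.
have := via_projection pz ga; have := (hull_funP f).1 y a.
by rewrite (metric_sym b) in fby; split=> //; lra.
Qed.

Lemma hull_projections_close f g a b (r : R) :
  gamma a -> (forall x, gamma x -> f a <= f x + 1) ->
  gamma b -> (forall x, gamma x -> g b <= g x + 1) ->
  mdist f g <= r -> r < f a -> mdist a b <= 11 * K + 40.
Proof.
have C_ge0 := C0; have defK : K = 4 * C + 16 by [].
move=> ga amin gb bmin fg ra.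
have [y [z [pz fy zside]]] := partner_behind_min ga amin gb.
have [y' [z' [pz' gy' zside']]] := partner_behind_min gb bmin ga.
rewrite (metric_sym b a) in zside'.
have [[gz yz] [gz' yz']] := (pz, pz').
have [short|long] := leP (2 * mdist a b) (3 * K + 10).
  by lra.
have align := geodesic_align gamma_geo ga gb gz gz' long zside zside'.
have g0 := hull_Delta_ge0 b (hull_funP g).1.
have za0 := mdist_ge0 z a; have z'b0 := mdist_ge0 z' b.
have [near|far] := leP (mdist z z') (2 * C + 8); first lra.
have yy' := far_projections_dist C0 gamma0 gX contr pz pz' far.
have ya := metric_triangle y z a; have y'b := metric_triangle y' z' b.
have gyy' := (hull_funP g).1 y y'.
have := le_trans (ler_norm _) (hull_dist_ge g f y).
by rewrite hull_dist_sym => /le_trans/(_ fg); lra.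
Qed.

Lemma hull_strongly_contracting :
  strongly_contracting_with (88 * C + 432) [set hull_embed x | x in gamma].
Proof.
have defK : K = 4 * C + 16 by [].
move=> f r r0 disj; apply: ge_ereal_sup => _ [[u v] [/= Bu Bv] <-].
rewrite lee_fin /=.
have far x : gamma x -> r < f x.
  move=> gx; rewrite ltNge; apply/negP => le_r.
  have : (metric_cball f r `&` [set hull_embed x | x in gamma]) (hull_embed x).
    by split; [rewrite /metric_cball /= hull_dist_embed | exists x].
  by rewrite disj.
have [_ /coarse_proj_hullP[a [ga _ amin]]] :
    exists w, coarse_proj [set hull_embed x | x in gamma] f w.
  by apply: coarse_projN0; have [x gx] := gamma0; exists (hull_embed x), x.
have close w : coarse_proj_set [set hull_embed x | x in gamma]
    (metric_cball f r) w -> mdist (hull_embed a) w <= 11 * K + 40.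
  move=> [g fg /coarse_proj_hullP[b [gb -> bmin]]].
  rewrite hull_embed_isometry.
  exact: (hull_projections_close ga amin gb bmin fg (far _ ga)).
have := close _ Bu; have := close _ Bv; rewrite (metric_sym _ u) => av ua.
apply: (le_trans (metric_triangle u (hull_embed a) v)); lra.
Qed.

End HullContraction.

Theorem theorem2 (R : realType) :
  (forall (X : metricType R) (gamma : set X),
     geodesic_space X -> geodesic gamma ->
     strongly_contracting gamma ->
     strongly_contracting [set hull_embed x | x in gamma]) /\
  (forall C : R, 0 <= C -> exists D : R, 0 <= D /\
     forall (X : metricType R) (gamma : set X),
       geodesic_space X -> geodesic gamma ->
       strongly_contracting_with C gamma ->
       strongly_contracting_with D [set hull_embed x | x in gamma]).
Proof.
split=> [X gamma gX geo [C contr]|C C0].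
  (* A contraction constant may be negative when no ball misses [gamma]. *)
  exists (88 * Num.max 0 C + 432); apply: hull_strongly_contracting => //.
    by rewrite le_max lexx.
  move=> c r r0 disj; apply: le_trans (contr c r r0 disj) _.
  by rewrite lee_fin le_max lexx orbT.
exists (88 * C + 432); split; first lra.
by move=> X gamma gX geo contr; exact: hull_strongly_contracting.
Qed.
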